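(* Let $Q\in\mathcal B$ with $\Lambda(Q)>0$. (i) Suppose there exist $0<\epsilon<e\Lambda(Q)$ and $\gamma\in[0,1)$ such that $$\mathcal K_{\gamma,\epsilon}(\Lambda|\phi_0)(Q)<\frac{\Lambda(Q)}{1-\gamma}\log\frac{\Lambda(Q)}{\epsilon}.$$ Then $\mathcal H_\alpha(\Lambda,\phi_0)(Q)>0$ for all $\alpha\in[0,\gamma]$. (ii) Suppose there exists a function $\tau:(0,1]\to[0,\infty)$ which is continuous at $1$ such that $\tau(1)=0$, $\tau(\alpha)>0$ for all $\alpha\in(0,1)$, and $$\liminf_{\alpha\to1,\ \alpha<1}(1-\alpha)\,\mathcal K_{\alpha,\tau(\alpha)}(\Lambda|\phi_0)(Q)<\infty .$$ Then $\mathcal H_\alpha(\Lambda,\phi_0)(Q)>0$ for all $\alpha\in[0,1]$.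
   Context: Setting. Let $X$ be a set, $S:X\to X$ a bijection, $\mathcal A$ a $\sigma$-algebra on $X$, $\mathcal A_0$ the $\sigma$-algebra generated by $\bigcup_{i\ge 0}S^{-i}\mathcal A$, $\mathcal B$ the $\sigma$-algebra generated by $\bigcup_{i\in\mathbb Z}S^{-i}\mathcal A$, and $\mathcal A_m:=S^{-m}\mathcal A_0=\{S^{-m}A:A\in\mathcal A_0\}$ for integers $m\le 0$ (so $\mathcal A_0\subset\mathcal A_{-1}\subset\cdots$). Let $\phi_0$ be a finite positive measure on $\mathcal A_0$, and $\Lambda$ a finite positive measure on $\mathcal A_0$ with $\Lambda\circ S^{-1}=\Lambda$ and $\Lambda\ll\phi_0$; let $Z\ge0$ be an $\mathcal A_0$-measurable version of $d\Lambda/d\phi_0$. For $Q\subset X$ let $\mathcal C(Q)$ be the set of all sequences $(A_m)_{m\le0}$ with $A_m\in\mathcal A_m$ for all $m\le 0$ and $Q\subset\bigcup_{m\le0}A_m$. The symbol $\Lambda$ also denotes $\Lambda(Q):=\inf_{(A_m)\in\mathcal C(Q)}\sum_{m\le0}\Lambda(S^mA_m)$, $Q\subset X$; its restriction to $\mathcal B$ is the unique $S$-invariant measure on $\mathcal B$ extending $\Lambda$. Conventions: extended real numbers are used, $0\log0:=0$, $y^x:=e^{x\log y}$ and thus $0^0:=1$. For $\alpha\ge0$ and $Q\subset X$: $\mathcal H_\alpha(\Lambda,\phi_0)(Q):=\inf_{(A_m)\in\mathcal C(Q)}\sum_{m\le0}\int_{S^mA_m}Z^\alpha d\phi_0$.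 For $\epsilon>0$ and $0\le\alpha\le1$ let $\mathcal C^\alpha_\epsilon(Q):=\{(A_m)\in\mathcal C(Q):\sum_{m\le0}\int_{S^mA_m}Z^\alpha d\phi_0<\mathcal H_\alpha(\Lambda,\phi_0)(Q)+\epsilon\}$. For $0\le\alpha<1$ and $\epsilon>0$, $\mathcal K_{\alpha,\epsilon}(\Lambda|\phi_0)(Q):=\inf_{(A_m)\in\mathcal C^\alpha_\epsilon(Q)}\sum_{m\le0}\int_{S^mA_m}Z\log Z\,d\phi_0$ (the sums are well defined in $(-\infty,\infty]$). *)

(* Defs.v *)
From HB Require Import structures.
From mathcomp Require Import all_boot all_order all_algebra.
From mathcomp Require Import all_classical all_reals all_analysis.
From mathcomp Require Import measurable_realfun.
Set Implicit Arguments.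
Unset Strict Implicit.
Unset Printing Implicit Defensive.
Import Order.TTheory GRing.Theory Num.Theory.
Import numFieldNormedType.Exports.
Local Open Scope classical_set_scope.
Local Open Scope ring_scope.

Section dynamics.
Context {X : pointedType}.
Implicit Types (S : X -> X) (A : set (set X)) (Q : set X).

(* S^m E for an integer m; for m < 0 this is a preimage. It is the image of E
   under the m-th power of S in the group of bijections when S is bijective. *)
Definition zimage S (m : int) (E : set X) : set X :=
  match m with
  | Posz n => iter n S @` E
  | Negz n => iter n.+1 S @^-1` E
  end.

(* The family S^m A = { S^m E : E in A }. *)
Definition zimages S (m : int) A : set (set X) := [set zimage S m E | E in A].

Definition past_generators S A : set (set X) :=
  \bigcup_(i in [set: nat]) zimages S (- i%:Z) A.

Definition past_sigma S A : set (set X) := <<s past_generators S A >>.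

Definition full_sigma S A : set (set X) :=
  <<s \bigcup_(i in [set: int]) zimages S (- i) A >>.

(* A_m = S^{-m} A_0; used for m <= 0 only. *)
Definition sigma_at S A (m : int) : set (set X) :=
  zimages S (- m) (past_sigma S A).

(* Sequences indexed by the integers m <= 0 are indexed by n = - m : nat,
   so that C n stands for A_(-n). *)
Definition covers S A Q : set (nat -> set X) :=
  [set C | (forall n, sigma_at S A (- n%:Z) (C n)) /\ Q `<=` \bigcup_n C n].

End dynamics.

(* X equipped with the sigma-algebra A_0. *)
Notation past_type S A := (g_sigma_algebraType (past_generators S A)).

Local Open Scope ereal_scope.

Section measures.
Context {R : realType} {X : pointedType} {S : X -> X} {A : set (set X)}.
Context (Lambda phi0 : {finite_measure set (past_type S A) -> \bar R})
  (Z : past_type S A -> \bar R).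
Implicit Types (Q : set X) (alpha eps : R).

Definition Lambda_ext Q : \bar R :=
  ereal_inf [set \sum_(0 <= n <oo) Lambda (zimage S (- n%:Z) (C n))
            | C in covers S A Q].

(* `^ is the power with 0 `^ 0 = 1 and +oo `^ 0 = 1. *)
Definition power_sum alpha (C : nat -> set X) : \bar R :=
  \sum_(0 <= n <oo) \int[phi0]_(x in zimage S (- n%:Z) (C n)) (Z x `^ alpha).

Definition Hmeas alpha Q : \bar R :=
  ereal_inf [set power_sum alpha C | C in covers S A Q].

Definition near_optimal_covers alpha eps Q : set (nat -> set X) :=
  [set C | covers S A Q C /\
           power_sum alpha C < Hmeas alpha Q + eps%:E].

(* At Z x = 0 the integrand is 0 * -oo = 0. The terms may have any sign; the
   series is the limit of its partial sums. When power_sum alpha C is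
   finite with alpha < 1, the negative parts of the terms are summable (as
   (t ln t)^- <= c * t `^ alpha), so this limit exists in ]-oo, +oo]. *)
Definition entropy_sum (C : nat -> set X) : \bar R :=
  \sum_(0 <= n <oo) \int[phi0]_(x in zimage S (- n%:Z) (C n)) (Z x * lne (Z x)).

Definition Kent alpha eps Q : \bar R :=
  ereal_inf [set entropy_sum C
            | C in near_optimal_covers alpha eps Q].

(* Z takes values in [0, +oo]. *)
Definition density_version : Prop :=
  [/\ forall x, 0 <= Z x,
      measurable_fun setT Z &
      forall E : set (past_type S A), measurable E ->
        Lambda E = \int[phi0]_(x in E) Z x].

End measures.

(* Main.v *)
Require Import Defs.
From HB Require Import structures.
From mathcomp Require Import all_boot all_order all_algebra.
From mathcomp Require Import all_classical all_reals all_analysis.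
From mathcomp Require Import measurable_realfun.
From mathcomp Require Import ring lra zify.
Import Order.TTheory GRing.Theory Num.Theory.
Import numFieldNormedType.Exports.
Local Open Scope classical_set_scope.
Local Open Scope ring_scope.
Local Open Scope ereal_scope.

(** By [ln u <= u - 1] at [u = c * z `^ (gamma - 1)], [z ln z] dominates an
    affine combination of [z] and [- z `^ gamma]. If [Hmeas gamma Q = 0], the
    near-optimal covers have power sum below [eps], and summing this tangent
    inequality with [c = Lambda Q / eps] over such a cover bounds [Kent] below
    by [Lambda Q / (1 - gamma) * ln (Lambda Q / eps)].

    Moreover [Hmeas alpha Q = 0] propagates upwards to [alpha <= gamma < 1]: the
    sets of a cover can be made disjoint, which by invariance bounds the sum of
    their [Lambda]-masses by [Lambda setT], and [z `^ gamma] is at most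
    [eta * z + B * z `^ alpha] with [eta] arbitrarily small. For (ii) the
    bound on [Kent] then holds for all exponents close to [1], and it blows up
    after multiplication by [1 - gamma]. *)

(** * Inequalities for z ln z and powers of z, pointwise, integrated and summed *)

Lemma measurable_lne (R : realType) : measurable_fun setT (@lne R).
Proof.
have -> : @lne R = fun x =>
    if x == +oo then +oo else if x <= 0 then -oo else (ln (fine x))%:E.
  by apply/funext => -[r| |] /=; rewrite ?lee_fin ?leNye.
apply: measurable_fun_ifT => //=; first exact: measurable_fun_eqe.
apply: measurable_fun_ifT => //=; first exact: measurable_fun_lee.
apply/measurable_EFinP.
exact: (@measurableT_comp _ _ _ _ _ _ (@ln R)).
Qed.

Section entropy_tangent.
Context {R : realType}.
Variables (c gamma : R).
Hypotheses (c0 : (0 < c)%R) (lnc : (0 <= 1 + ln c)%R) (g1 : (gamma < 1)%R).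

(** The coefficients come from multiplying the tangent inequality by [r / (1 - gamma)]. The
    hypothesis [lnc] says that [c] is at least 1/e, which makes [a] nonnegative. *)
Let a := ((1 + ln c) / (1 - gamma))%R.
Let b := (c / (1 - gamma))%R.

Let a0 : (0 <= a)%R.
Proof. by rewrite divr_ge0// subr_ge0 ltW. Qed.

Let b0 : (0 <= b)%R.
Proof. by rewrite divr_ge0// ltW// subr_gt0. Qed.

(* This is [ln u <= u - 1] at [u = c * r `^ (gamma - 1)]. *)
Lemma entropy_tangent_real (r : R) : (0 < r)%R ->
  (a * r <= r * ln r + b * r `^ gamma)%R.
Proof.
move=> r0.
pose u := (c * r `^ (gamma - 1))%R.
have u0 : (0 < u)%R by rewrite mulr_gt0// powR_gt0.
have lnu : (ln u = ln c + (gamma - 1) * ln r)%R.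
  by rewrite lnM ?posrE ?powR_gt0// ln_powR.
have tangent : (ln u <= u - 1)%R.
  by rewrite -{1}(subrKC 1%R u) le_ln1Dx// ltrBDr addrC subrr.
have rg : (r `^ gamma = r * r `^ (gamma - 1))%R.
  by rewrite -{2}(powRr1 (ltW r0)) -powRD ?subrKC// (gt_eqF r0) implybT.
have g0 : (0 < 1 - gamma)%R by rewrite subr_gt0.
rewrite -(ler_pM2l g0).
have -> : ((1 - gamma) * (a * r) = (1 + ln c) * r)%R.
  by rewrite /a; field; rewrite gt_eqF.
have -> : ((1 - gamma) * (r * ln r + b * r `^ gamma) =
          (1 - gamma) * ln r * r + u * r)%R.
  by rewrite rg /b /u; field; rewrite gt_eqF.
rewrite -mulrDl ler_pM2r//; lra.
Qed.

Let f (z : \bar R) := z * lne z.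

(** The negative part stands on the left so that only nonnegative terms occur and both sides can be
    integrated before any finiteness is known. *)
Lemma entropy_tangent (z : \bar R) : 0 <= z ->
  a%:E * z + f^\- z <= f^\+ z + b%:E * z `^ gamma.
Proof.
have pow_ge0 t : 0 <= b%:E * t `^ gamma by rewrite mule_ge0// poweR_ge0.
rewrite funenegE funeposE /f; case: z => [r| |//] r0; last first.
  by rewrite mulyy maxNye// maxye [leRHS]addye ?leey// gt_eqF// (lt_le_trans _ (pow_ge0 _)).
move: r0; rewrite lee_fin le_eqVlt => /predU1P[<-|r0].
  by rewrite !mul0e mule0 oppe0 !maxxx !add0e pow_ge0.
have := @entropy_tangent_real r r0.
rewrite lne_EFin// poweR_EFin -!EFinM -EFinN -!EFin_max -!EFinD lee_fin => H.
have [rl|rl] := leP 0%R (r * ln r)%R.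
  by rewrite (max_idPr _) ?oppr_le0// addr0.
by rewrite (max_idPl _) ?oppr_ge0 ?(ltW rl)//; lra.
Qed.

Lemma entropy_tangent_neg (z : \bar R) : 0 <= z ->
  f^\- z <= b%:E * z `^ gamma.
Proof.
move=> z0.
have b_ge0 : 0 <= b%:E * z `^ gamma by rewrite mule_ge0// poweR_ge0.
have [fz|fz] := leP 0 (f z).
  by rewrite funenegE (max_idPr _) ?oppe_le0.
have := entropy_tangent _ z0.
rewrite funeposE (max_idPr (ltW fz)) add0e; apply: le_trans.
by rewrite leeDr// mule_ge0.
Qed.

End entropy_tangent.

(** Split at the threshold [T] with [T] to the power [gamma - 1] equal to [eta]. Above [T], the
    factor of exponent [gamma - 1] is at most [eta]; below [T], the factor of exponent
    [gamma - alpha] is at most its value [B] at [T]. *)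
Lemma poweR_interpolation (R : realType) (alpha gamma eta : R) :
  (0 <= alpha < gamma)%R -> (gamma < 1)%R -> (0 < eta)%R ->
  exists2 B : R, (0 < B)%R & forall z : \bar R, 0 <= z ->
    z `^ gamma <= eta%:E * z + B%:E * z `^ alpha.
Proof.
move=> /andP[a0 ag] g1 eta0.
have g0 : (0 < gamma)%R by exact: le_lt_trans ag.
pose T := (eta `^ (gamma - 1)^-1)%R.
have T0 : (0 < T)%R by rewrite powR_gt0.
exists (T `^ (gamma - alpha))%R => [|z]; first by rewrite powR_gt0.
have pow_ge0 t : 0 <= (T `^ (gamma - alpha))%:E * t `^ alpha.
  by rewrite mule_ge0// ?lee_fin ?powR_ge0// poweR_ge0.
case: z => [r| |//]; last first.
  by rewrite gt0_muley// addye ?leey// gt_eqF// (lt_le_trans _ (pow_ge0 _)).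
rewrite !poweR_EFin -!EFinM -EFinD !lee_fin le_eqVlt => /predU1P[<-|r0].
  by rewrite powR0 ?gt_eqF// mulr0 add0r mulr_ge0 ?powR_ge0.
have split s : (r `^ gamma = r `^ (gamma - s) * r `^ s)%R.
  by rewrite -powRD ?subrK// (gt_eqF r0) implybT.
have [rT|Tr] := leP r T.
  rewrite (split alpha) -[leLHS]add0r; apply: lerD.
    by rewrite mulr_ge0 ?ltW.
  by rewrite ler_wpM2r ?powR_ge0// ge0_ler_powR ?nnegrE ?subr_ge0// ltW.
rewrite (split 1%R) powRr1 ?(ltW r0)// -[leLHS]addr0; apply: lerD; last first.
  by rewrite mulr_ge0 ?powR_ge0.
rewrite ler_wpM2r ?(ltW r0)//.
have -> : eta = (T `^ (gamma - 1))%R.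
  have g10 : (gamma - 1 != 0)%R by rewrite subr_eq0 lt_eqF.
  by rewrite -powRrM mulVf// powRr1// ltW.
rewrite -[(gamma - 1)%R]opprB !powRN lef_pV2 ?posrE ?powR_gt0//.
by rewrite ge0_ler_powR ?nnegrE ?subr_ge0// ltW.
Qed.

(** The terms of [e] may have any sign, so its series is obtained as the difference of the
    nonnegative series of [e + p] and [p], the latter having a finite sum. *)
Lemma nneseries_le_addr (R : realType) (u e p : (\bar R)^nat) :
  (forall n, 0 <= u n) -> (forall n, 0 <= p n) ->
  (forall n, u n <= e n + p n) -> \sum_(0 <= n <oo) p n < +oo ->
  \sum_(0 <= n <oo) u n <= \sum_(0 <= n <oo) e n + \sum_(0 <= n <oo) p n.
Proof.
move=> u0 p0 uep sp.
pose g n := e n + p n.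
have g0 n : 0 <= g n by exact: le_trans (uep n).
have psumE n : (\sum_(0 <= k < n) p k) \is a fin_num.
  rewrite ge0_fin_numE ?sume_ge0//.
  by apply: le_lt_trans sp; exact: nneseries_lim_ge.
have pE n : p n \is a fin_num.
  rewrite ge0_fin_numE//; apply: le_lt_trans sp.
  by rewrite (le_trans _ (nneseries_lim_ge n.+1 _))// big_nat_recr//= leeDr// sume_ge0.
have P_fin : \sum_(0 <= n <oo) p n \is a fin_num.
  by rewrite ge0_fin_numE// nneseries_ge0.
have -> : \sum_(0 <= n <oo) e n =
    \sum_(0 <= n <oo) g n - \sum_(0 <= n <oo) p n.
  apply/cvg_lim => //.
  rewrite (_ : (fun n => \sum_(0 <= k < n) e k) =
    (fun n => \sum_(0 <= k < n) g k) \- (fun n => \sum_(0 <= k < n) p k)).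
    by apply: cvgeB; [rewrite fin_num_adde_defl// fin_numN|
      exact: is_cvg_nneseries|exact: is_cvg_nneseries].
  apply/funext => n /=; elim: n => [|n IH]; first by rewrite !big_geq// subee.
  rewrite !big_nat_recr//= IH fin_num_oppeD// addeACA; congr (_ + _).
  by rewrite /g addeK.
by rewrite subeK//; exact: lee_nneseries.
Qed.

(** The finite integral of the power bounds that of the negative part of the entropy, which can then
    be subtracted after integrating [entropy_tangent]. *)
Lemma integral_entropy_tangent (d : measure_display) (T : measurableType d)
    (R : realType) (mu : {measure set T -> \bar R}) (f : T -> \bar R)
    (D : set T) (c gamma : R) :
  measurable_fun setT f -> (forall x, 0 <= f x) -> measurable D ->
  (0 < c)%R -> (0 <= 1 + ln c)%R -> (gamma < 1)%R ->
  \int[mu]_(x in D) (f x `^ gamma) < +oo ->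
  ((1 + ln c) / (1 - gamma))%:E * \int[mu]_(x in D) f x <=
    \int[mu]_(x in D) (f x * lne (f x)) +
    (c / (1 - gamma))%:E * \int[mu]_(x in D) (f x `^ gamma).
Proof.
move=> mf f0 mD c0 lnc g1 powoo.
set a := ((1 + ln c) / (1 - gamma))%R; set b := (c / (1 - gamma))%R.
have a0 : (0 <= a)%R by rewrite divr_ge0// subr_ge0 ltW.
have b0 : (0 <= b)%R by rewrite divr_ge0 ?(ltW c0)// subr_ge0 ltW.
pose h x := f x * lne (f x).
have mfD : measurable_fun D f by exact: measurable_funTS.
have mh : measurable_fun D h.
  apply: emeasurable_funM => //; apply: measurable_funTS.
  exact: (measurableT_comp (@measurable_lne R)).
have mpow : measurable_fun D (fun x => f x `^ gamma).
  by apply: measurable_funTS; exact: (measurableT_comp (@measurable_poweR R gamma)).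
have mpos := measurable_funepos mh.
have mneg := measurable_funeneg mh.
have pow0 x : 0 <= f x `^ gamma by exact: poweR_ge0.
have bpow0 x : D x -> 0 <= b%:E * f x `^ gamma by move=> _; rewrite mule_ge0.
have mbpow : measurable_fun D (fun x => b%:E * f x `^ gamma).
  exact: emeasurable_funM.
have maf : measurable_fun D (fun x => a%:E * f x) by exact: emeasurable_funM.
have intb : \int[mu]_(x in D) (b%:E * f x `^ gamma) =
    b%:E * \int[mu]_(x in D) (f x `^ gamma) by rewrite ge0_integralZl_EFin.
have neg_fin : \int[mu]_(x in D) h^\- x \is a fin_num.
  rewrite ge0_fin_numE ?integral_ge0//.
  apply: (@le_lt_trans _ _ (\int[mu]_(x in D) (b%:E * f x `^ gamma))).
    apply: ge0_le_integral => // x _.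
    by have := entropy_tangent_neg _ _ c0 lnc g1 _ (f0 x); rewrite !funenegE.
  by rewrite intb lte_mul_pinfty.
rewrite (integralE _ _ h) -addeAC leeBrDr//.
rewrite -ge0_integralZl_EFin// -intb -!ge0_integralD//; last first.
  by move=> x _; rewrite mule_ge0.
apply: ge0_le_integral => //.
- by move=> x _; rewrite adde_ge0// mule_ge0.
- exact: emeasurable_funD.
- exact: emeasurable_funD.
move=> x _; have := entropy_tangent _ _ c0 g1 _ (f0 x).
by rewrite !funenegE !funeposE.
Qed.

(** * Covers, their pullbacks and their disjointification *)

Section covers_theory.
Context {X : pointedType} {S : X -> X} {A : set (set X)}.
Implicit Types (E : nat -> set (past_type S A)) (Q : set X).

Lemma zimageN n (E : set X) : zimage S (- n%:Z) E = iter n S @^-1` E.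
Proof.
case: n => [|n]; last by rewrite -NegzE.
by rewrite oppr0 /= image_id.
Qed.

(** Generators suffice, and a preimage under [S] only raises the index [i] of a generator by one. *)
Lemma measurable_shift (E : set (past_type S A)) :
  measurable E -> measurable (S @^-1` E : set (past_type S A)).
Proof.
suff mS : measurable_fun setT (S : past_type S A -> past_type S A).
  by move=> mE; rewrite -[_ @^-1` _]setTI; exact: mS.
apply: (@measurability _ _ (past_type S A) (past_type S A) setT S (past_generators S A)) => //.
move=> _ [_ [i _ [B AB <-]] <-]; apply: sub_gen_smallest.
exists i.+1 => //; exists B => //.
by rewrite !zimageN setTI; apply/seteqP; split => x; rewrite /= -iterSr.
Qed.

Lemma measurable_iter_shift n (E : set (past_type S A)) :
  measurable E -> measurable (iter n S @^-1` E : set (past_type S A)).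
Proof.
move=> mE; elim: n => [//|n IH].
have -> : iter n.+1 S @^-1` E = S @^-1` (iter n S @^-1` E).
  by apply/seteqP; split => x; rewrite /= -iterSr.
exact: measurable_shift.
Qed.

(** A cover is handled through the pullbacks [E n] of its members, which all lie in the one
    sigma-algebra [past_sigma S A] and are the sets over which the sums are taken. *)
Definition cover_of E : nat -> set X := fun n => iter n S @` E n.

Hypothesis injS : injective S.

Lemma inj_iter n : injective (iter n S).
Proof. by elim: n => [//|n IH] x y /= /injS /IH. Qed.

Lemma zimage_cover_of E n : zimage S (- n%:Z) (cover_of E n) = E n.
Proof.
rewrite zimageN; apply/seteqP; split => x /= => [[y Ey /inj_iter <-]//|Ex].
by exists x.
Qed.

Lemma coversP Q (C : nat -> set X) : covers S A Q C <->
  exists E, [/\ forall n, measurable (E n), C = cover_of E &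
                Q `<=` \bigcup_n cover_of E n].
Proof.
split => [[sC QC]|[E [mE -> QE]]].
  have /choice[E EP] n : exists E : set (past_type S A),
      measurable E /\ C n = iter n S @` E.
    by have [E mE <-] := sC n; exists E; rewrite opprK.
  have CE : C = cover_of E by apply/funext => n; have [] := EP n.
  by exists E; split; [move=> n; have [] := EP n|by []|rewrite -CE].
split => // n; exists (E n); first exact: mE.
by rewrite opprK.
Qed.

(** Serves to bound [Lambda_ext] by the total mass of [Lambda]. *)
Definition full_cover : nat -> set (past_type S A) :=
  fun n => if n is 0%N then setT else set0.

Lemma covers_full Q : covers S A Q (cover_of full_cover).
Proof.
apply/coversP; exists full_cover; split => //.
  by case=> [|n]; [exact: measurableT|exact: measurable0].
by move=> x _; exists 0%N => //; exists x.
Qed.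

(* The pullback of [cover_of E] after removing from each set its predecessors. *)
Definition disjointified E : nat -> set (past_type S A) :=
  fun n => E n `\` \bigcup_(k in `I_n) (iter (n - k) S @^-1` E k).

Lemma measurable_disjointified E n :
  (forall n, measurable (E n)) -> measurable (disjointified E n).
Proof.
move=> mE; apply: measurableD => //; apply: bigcup_measurable => k _.
exact: measurable_iter_shift.
Qed.

Lemma disjointified_sub E n : disjointified E n `<=` E n.
Proof. by move=> x []. Qed.

(** Strong induction on the index: a point lost in passing from [E n] to [disjointified E n] is
    already covered by a member of smaller index. *)
Lemma bigcup_disjointified E :
  \bigcup_n cover_of E n `<=` \bigcup_n cover_of (disjointified E) n.
Proof.
move=> x [n _]; elim/ltn_ind: n => n IH [y Ey yx].
have [[k /= kn Ek]|ny] := pselect ((\bigcup_(k in `I_n) (iter (n - k) S @^-1` E k)) y).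
  apply: (IH k kn); exists (iter (n - k) S y) => //.
  by rewrite -iterD subnKC// ltnW.
by exists n => //; exists y.
Qed.

(** As [S] is injective, these sets are the preimages under [iter N S] of the members of the
    disjointified cover; for n < m, the m-th piece excludes all points that [iter (m - n) S] sends
    into [E n]. *)
Lemma trivIset_disjointified E N :
  trivIset `I_N.+1 (fun n => iter (N - n) S @^-1` disjointified E n).
Proof.
move=> n m /= nN mN [x [Dn Dm]]; apply/eqP; apply: contraT => nm.
wlog lt_nm : n m nN mN Dn Dm nm / (n < m)%N.
  move=> H; move: (nm); rewrite neq_ltn => /orP[|] ?; first exact: (H n m).
  by apply: (H m n) => //; rewrite eq_sym.
case: Dm => _ /=; case; exists n => //=.
rewrite -iterD; have -> : (m - n + (N - m) = N - n)%N by lia.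
exact: disjointified_sub Dn.
Qed.

Context {R : realType}.
Variable mu : {finite_measure set (past_type S A) -> \bar R}.
Hypothesis mu_inv : forall E : set (past_type S A), measurable E ->
  mu (S @^-1` E) = mu E.

Lemma measure_iter_shift n (E : set (past_type S A)) : measurable E ->
  mu (iter n S @^-1` E) = mu E.
Proof.
move=> mE; elim: n => [//|n <-].
rewrite -[RHS]mu_inv; last exact: measurable_iter_shift.
by congr (mu _); apply/seteqP; split => x; rewrite /= -iterSr.
Qed.

(** By invariance, each term of a partial sum is the mass of a pullback to the common time [N], and
    these pullbacks are disjoint. *)
Lemma sum_disjointified E : (forall n, measurable (E n)) ->
  \sum_(0 <= n <oo) mu (disjointified E n) <= mu setT.
Proof.
move=> mE; apply: lime_le; first exact: is_cvg_nneseries.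
apply: nearW => N.
have mD n : measurable (iter (N - n) S @^-1` disjointified E n : set (past_type S A)).
  by apply: measurable_iter_shift; exact: measurable_disjointified.
have trivD : trivIset `I_N (fun n => iter (N - n) S @^-1` disjointified E n).
  apply: (@sub_trivIset _ _ _ `I_N.+1) => [n /= /ltnW//|].
  exact: trivIset_disjointified.
rewrite big_mkord.
rewrite (eq_bigr (fun n : 'I_N => mu (iter (N - n) S @^-1` disjointified E n))).
  rewrite (fsbig_ord _ _ (fun n => mu (iter (N - n) S @^-1` disjointified E n))).
  rewrite -measure_fin_bigcup//.
  by apply: le_measure; rewrite ?inE//; exact: bigcup_measurable.
by move=> n _; rewrite measure_iter_shift//; exact: measurable_disjointified.
Qed.

End covers_theory.

(** * Zeros of [Hmeas] and the lower bound on [Kent] *)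

Section corollary.
Context {R : realType} {X : pointedType} {S : X -> X} {A : set (set X)}.
Variables (phi0 Lambda : {finite_measure set (past_type S A) -> \bar R}).
Variables (Z : past_type S A -> \bar R) (Q : set X).
Hypothesis injS : injective S.
Hypothesis Lambda_inv : forall E : set (past_type S A), measurable E ->
  Lambda (S @^-1` E) = Lambda E.
Hypothesis ZP : density_version Lambda phi0 Z.

Let Z0 x : 0 <= Z x.
Proof. by have [] := ZP. Qed.

Let mZ : measurable_fun setT Z.
Proof. by have [] := ZP. Qed.

Let LambdaE E : measurable E -> Lambda E = \int[phi0]_(x in E) Z x.
Proof. by have [_ _] := ZP; exact. Qed.

Let mZD D : measurable_fun D Z.
Proof. exact: measurable_funTS. Qed.

Let pow_ge0 alpha x : 0 <= Z x `^ alpha.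
Proof. exact: poweR_ge0. Qed.

Let mpow alpha D : measurable_fun D (fun x => Z x `^ alpha).
Proof.
apply: measurable_funTS.
exact: (measurableT_comp (@measurable_poweR R alpha)).
Qed.

Let pow_int_ge0 alpha D : 0 <= \int[phi0]_(x in D) (Z x `^ alpha).
Proof. exact: integral_ge0. Qed.

Lemma power_sum_cover_of alpha (E : nat -> set (past_type S A)) :
  power_sum phi0 Z alpha (cover_of E) =
  \sum_(0 <= n <oo) \int[phi0]_(x in E n) (Z x `^ alpha).
Proof. by apply: eq_eseriesr => n _; rewrite zimage_cover_of. Qed.

Lemma Hmeas_ge0 alpha : 0 <= Hmeas phi0 Z alpha Q.
Proof. by apply: le_ereal_inf_tmp => _ [C _ <-]; exact: nneseries_ge0. Qed.

Lemma Lambda_ext_fin_num : Lambda_ext Lambda Q \is a fin_num.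
Proof.
rewrite ge0_fin_numE; last first.
  by apply: le_ereal_inf_tmp => _ [C _ <-]; exact: nneseries_ge0.
apply: (@le_lt_trans _ _ (Lambda setT)); last first.
  by rewrite -ge0_fin_numE// fin_num_measure.
apply: ereal_inf_lbound; exists (cover_of (S := S) (A := A) full_cover).
  exact: covers_full.
under eq_eseriesr do rewrite zimage_cover_of//.
rewrite (@nneseries_recl _ xpredT (fun n => Lambda (full_cover n)))//.
by rewrite eseries0 ?adde0// => -[//|n] _ _; rewrite measure0.
Qed.

Lemma Hmeas1E : Hmeas phi0 Z 1 Q = Lambda_ext Lambda Q.
Proof.
congr ereal_inf; apply: eq_imagel => C /coversP[E [mE -> _]].
rewrite power_sum_cover_of; apply: eq_eseriesr => n _.
rewrite zimage_cover_of// LambdaE//.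
by apply: eq_integral => x _; rewrite poweRe1.
Qed.

Lemma Hmeas_eq0_le alpha gamma : (0 <= alpha <= gamma)%R -> (gamma < 1)%R ->
  Hmeas phi0 Z alpha Q = 0 -> Hmeas phi0 Z gamma Q = 0.
Proof.
move=> /andP[a0]; rewrite le_eqVlt => /predU1P[->//|ag] g1 Ha.
apply/eqP; rewrite eq_le Hmeas_ge0 andbT; apply/lee_addgt0Pr => d d0.
pose M := fine (Lambda setT).
have ME : Lambda setT = M%:E by rewrite fineK// fin_num_measure.
have M0 : (0 <= M)%R by rewrite fine_ge0.
(* Half of [d] is left for the [Lambda] part of the interpolation and half for the [alpha] part;
   [M + 1] avoids division by zero. *)
pose eta := (d / 2 / (M + 1))%R.
have eta0 : (0 < eta)%R by rewrite !divr_gt0// ltr_wpDl.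
have [|B B0 interp] := @poweR_interpolation R alpha gamma eta _ g1 eta0.
  by rewrite a0.
have : Hmeas phi0 Z alpha Q < (d / 2 / B)%:E.
  by rewrite Ha lte_fin !divr_gt0.
move=> /ereal_inf_lt[_ [C /coversP[E [mE -> QE]] <-]].
rewrite power_sum_cover_of => small.
pose D := disjointified E.
have mD n : measurable (D n) by exact: measurable_disjointified.
have covD : covers S A Q (cover_of D).
  apply/coversP; exists D; split => //.
  exact: subset_trans QE (bigcup_disjointified _).
rewrite add0e; apply: (@le_trans _ _ (power_sum phi0 Z gamma (cover_of D))).
  by apply: ereal_inf_lbound; exists (cover_of D).
rewrite power_sum_cover_of.
apply: (@le_trans _ _ (\sum_(0 <= n <oo) (eta%:E * Lambda (D n) +
    B%:E * \int[phi0]_(x in D n) (Z x `^ alpha)))).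
  apply: lee_nneseries => // n _.
  rewrite LambdaE// -!ge0_integralZl_EFin ?(ltW B0) ?(ltW eta0)//.
  rewrite -ge0_integralD//.
  - apply: ge0_le_integral => //.
    + by apply: emeasurable_funD; apply: emeasurable_funM.
    + by move=> x _; exact: interp.
  - by move=> x _; rewrite mule_ge0// lee_fin ltW.
  - exact: emeasurable_funM.
  - by move=> x _; rewrite mule_ge0// lee_fin ltW.
  - exact: emeasurable_funM.
rewrite nneseriesD; last 2 first.
- by move=> n _ _; rewrite mule_ge0// lee_fin ltW.
- by move=> n _ _; rewrite mule_ge0// lee_fin ltW.
rewrite !nneseriesZl//.
have -> : d%:E = (eta * (M + 1))%:E + (B * (d / 2 / B))%:E.
  rewrite -EFinD; congr EFin; rewrite /eta; field.
  by rewrite gt_eqF//= gt_eqF// ltr_wpDl.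
apply: leeD.
  rewrite (EFinM eta) lee_pmul2l// (le_trans (sum_disjointified _ Lambda_inv _ mE))//.
  by rewrite ME lee_fin lerDl.
rewrite (EFinM B) lee_pmul2l//; apply: le_trans (ltW small).
apply: lee_nneseries => // n _; apply: ge0_subset_integral => //.
exact: disjointified_sub.
Qed.

(* If [Hmeas gamma Q = 0], then every near-optimal cover has power sum at most
   [eps]; summing the tangent inequality with [c = l / eps] gives the bound. *)
Lemma Kent_ge (l eps gamma : R) : Lambda_ext Lambda Q = l%:E -> (0 < l)%R ->
  (0 < eps < expR 1 * l)%R -> (gamma < 1)%R -> Hmeas phi0 Z gamma Q = 0 ->
  (l / (1 - gamma) * ln (l / eps))%:E <= Kent phi0 Z gamma eps Q.
Proof.
move=> lE l0 /andP[eps0 epsl] g1 H0.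
apply: le_ereal_inf_tmp => _ [C [/coversP[E [mE -> QE]] +] <-].
rewrite H0 add0e power_sum_cover_of => small.
pose c := (l / eps)%R.
have c0 : (0 < c)%R by rewrite divr_gt0.
(* This is ln (e c) >= 0, which follows from [eps < expR 1 * l]. *)
have lnc : (0 <= 1 + ln c)%R.
  rewrite -[X in (X + _)%R](@expRK R) -lnM ?posrE ?expR_gt0// ln_ge0//.
  by rewrite mulrA ler_pdivlMr// mul1r ltW.
have g1' : (0 < 1 - gamma)%R by rewrite subr_gt0.
set a := ((1 + ln c) / (1 - gamma))%R; set b := (c / (1 - gamma))%R.
have a0 : (0 <= a)%R by rewrite divr_ge0// ltW.
have b0 : (0 < b)%R by rewrite divr_gt0.
pose p n := \int[phi0]_(x in E n) (Z x `^ gamma).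
have p0 n : 0 <= p n by exact: pow_int_ge0.
have sum_b : \sum_(0 <= n <oo) (b%:E * p n) = b%:E * \sum_(0 <= n <oo) p n.
  by rewrite nneseriesZl.
have sum_le : \sum_(0 <= n <oo) (b%:E * p n) <= (b * eps)%:E.
  by rewrite sum_b (EFinM b) lee_pmul2l// ltW.
have p_lty n : p n < +oo.
  apply: le_lt_trans (lt_trans small (ltry _)).
  by rewrite (le_trans _ (nneseries_lim_ge n.+1 _))// big_nat_recr//= leeDr// sume_ge0.
have key : \sum_(0 <= n <oo) (a%:E * Lambda (E n)) <=
    entropy_sum phi0 Z (cover_of E) + (b * eps)%:E.
  have -> : entropy_sum phi0 Z (cover_of E) =
      \sum_(0 <= n <oo) \int[phi0]_(x in E n) (Z x * lne (Z x)).
    by apply: eq_eseriesr => n _; rewrite zimage_cover_of.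
  apply: le_trans (leeD2l _ sum_le).
  apply: nneseries_le_addr.
  - by move=> n; rewrite mule_ge0.
  - by move=> n; rewrite mule_ge0// lee_fin ltW.
  - move=> n; rewrite LambdaE//.
    exact: (integral_entropy_tangent _ _ _ phi0 Z (E n) c gamma mZ Z0 (mE n) c0 lnc g1 (p_lty n)).
  - exact: le_lt_trans sum_le (ltry _).
have al : (a * l)%:E <= \sum_(0 <= n <oo) (a%:E * Lambda (E n)).
  rewrite nneseriesZl// (EFinM a) lee_wpmul2l// -lE.
  apply: ereal_inf_lbound; exists (cover_of E).
    by apply/coversP; exists E.
  by apply: eq_eseriesr => n _; rewrite zimage_cover_of.
have := le_trans al key.
rewrite -leeBlDr// -EFinB; apply: le_trans.
(* Since [c * eps = l], the term [b * eps] cancels the contribution of the summand 1 in [a]. *)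
rewrite lee_fin (_ : (l / (1 - gamma) * ln (l / eps) = a * l - b * eps)%R)//.
by rewrite /a /b -/c /c; field; rewrite !gt_eqF.
Qed.

End corollary.

(** * Both positivity criteria, by contradiction with the lower bound on [Kent] *)

Theorem corollary1 (R : realType) (X : pointedType) (S : X -> X)
  (A : set (set X)) (phi0 Lambda : {finite_measure set (past_type S A) -> \bar R})
  (Z : past_type S A -> \bar R) (Q : set X) :
  bijective S ->
  sigma_algebra [set: X] A ->
  (forall E : set (past_type S A), measurable E ->
     Lambda (S @^-1` E) = Lambda E) ->
  Lambda `<< phi0 ->
  density_version Lambda phi0 Z ->
  full_sigma S A Q ->
  0 < Lambda_ext Lambda Q ->
  (forall eps gamma : R,
     (0 < eps)%R -> eps%:E < (expR 1)%:E * Lambda_ext Lambda Q ->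
     (0 <= gamma < 1)%R ->
     Kent phi0 Z gamma eps Q <
       Lambda_ext Lambda Q / (1 - gamma)%:E * lne (Lambda_ext Lambda Q / eps%:E) ->
     forall alpha : R, (0 <= alpha <= gamma)%R -> 0 < Hmeas phi0 Z alpha Q)
  /\
  (forall tau : R -> R,
     (forall alpha : R, (0 < alpha <= 1)%R -> (0 <= tau alpha)%R) ->
     tau alpha @[alpha --> within [set` `]0%R, 1%R] ] (nbhs (1%R : R))] --> tau 1%R ->
     tau 1%R = 0%R ->
     (forall alpha : R, (0 < alpha < 1)%R -> (0 < tau alpha)%R) ->
     limf_einf (fun alpha : R => (1 - alpha)%:E * Kent phi0 Z alpha (tau alpha) Q)
       (at_left (1%R : R)) < +oo ->
     forall alpha : R, (0 <= alpha <= 1)%R -> 0 < Hmeas phi0 Z alpha Q).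
Proof.
move=> /bij_inj injS _ Linv _ ZP _ L0.
have [l lE] : exists l : R, Lambda_ext Lambda Q = l%:E.
  by exists (fine (Lambda_ext Lambda Q)); rewrite fineK// Lambda_ext_fin_num.
have l0 : (0 < l)%R by rewrite -lte_fin -lE.
rewrite lE; split => [eps gamma eps0|tau _ tau_cvg tau1 tau_gt0 liminf_lty].
  rewrite -EFinM lte_fin => epsl /andP[g0 g1] Klt alpha ag.
  rewrite lt_neqAle Hmeas_ge0 andbT eq_sym; apply/eqP => Ha.
  have Hg := Hmeas_eq0_le _ _ _ _ injS Linv ZP _ _ ag g1 Ha.
  have := Kent_ge _ _ _ _ injS ZP _ _ _ lE l0 _ g1 Hg.
  move=> /(_ eps); rewrite eps0 epsl => /(_ isT); rewrite leNgt => /negP; apply.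
  apply: (lt_le_trans Klt).
  rewrite !inver !gt_eqF ?subr_gt0// -!EFinM lne_EFin ?divr_gt0//.
(* At exponent 1, [Hmeas] equals [Lambda_ext]. Below 1, a zero of [Hmeas] is refuted by showing that
   the lower limit is [+oo]. *)
move=> alpha /andP[a0]; rewrite le_eqVlt => /predU1P[->|a1].
  by rewrite (Hmeas1E _ _ _ _ injS ZP) lE lte_fin.
rewrite lt_neqAle Hmeas_ge0 andbT eq_sym; apply/eqP => Ha.
move: liminf_lty; rewrite ltNge => /negP; apply.
rewrite leye_eq; apply/eqP/eq_infty => M.
(* The first bound on [tau t] gives [M <= l * ln (l / tau t)]; the second is the range of [eps] in
   [Kent_ge]. *)
pose K := Num.min (l / expR (M / l))%R (expR 1 * l)%R.
have K0 : (0 < K)%R by rewrite lt_min divr_gt0 ?mulr_gt0 ?expR_gt0.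
have tau_lt : \forall t \near nbhs (1%R : R), t \in `]0%R, 1%R] -> (tau t < K)%R.
  by apply: cvgr_lt tau_cvg _ _; rewrite tau1.
pose V := [set t : R | (alpha < t < 1)%R /\ (tau t < K)%R].
have FV : at_left (1%R : R) V.
  near=> t; have t1 : (t < 1)%R by near: t; exact: nbhs_left_lt.
  have ta : (alpha < t)%R by near: t; exact: nbhs_left_gt.
  split; first by rewrite ta.
  have : t \in `]0%R, 1%R] -> (tau t < K)%R by near: t; exact: cvg_within.
  by apply; rewrite in_itv/= (le_lt_trans a0 ta) ltW.
(* The lower limit is a supremum of infima over the sets of the filter, so a bound on [V] suffices.
   There [alpha < t < 1], so the zero of [Hmeas] at [alpha] passes to [t]. *)
rewrite limf_einfE.
apply: (@le_trans _ _ (ereal_inf ((fun t : R =>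
    (1 - t)%:E * Kent phi0 Z t (tau t) Q) @` V))); last first.
  by apply: ereal_sup_ubound; exists V.
apply: le_ereal_inf_tmp => _ [t [/andP[at_ t1] +] <-].
rewrite lt_min => /andP[tauM taul].
have t0 : (0 < t)%R by exact: le_lt_trans at_.
have tau0 : (0 < tau t)%R by rewrite tau_gt0// t0.
have Ht : Hmeas phi0 Z t Q = 0.
  by apply: (Hmeas_eq0_le _ _ _ _ injS Linv ZP alpha) => //; rewrite a0 ltW.
have t1' : (0 < 1 - t)%R by rewrite subr_gt0.
have := Kent_ge _ _ _ _ injS ZP _ (tau t) _ lE l0 _ t1 Ht.
rewrite tau0 taul => /(_ isT) /(lee_wpmul2l (ltW t1' : 0 <= (1 - t)%:E)).
apply: le_trans; rewrite -EFinM lee_fin.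
(* The weight [1 - t] cancels the denominator in the bound on [Kent]; what remains grows without
   bound as [tau t] tends to 0. *)
have -> : ((1 - t) * (l / (1 - t) * ln (l / tau t)) = ln (l / tau t) * l)%R.
  by field; rewrite gt_eqF.
rewrite -ler_pdivrMr// -[leLHS]expRK ler_ln ?posrE ?expR_gt0 ?divr_gt0//.
by rewrite ler_pdivlMr// mulrC -ler_pdivlMr ?expR_gt0// ltW.
Unshelve. all: by end_near.
Qed.
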